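(* Let $M$ be a $0,1$ matrix with $\mathrm{rank}_{\mathbb{R}}(M) = d$, where $d \in \{3,4\}$. Then $d \leq \mathrm{rank}_{\mathrm{bin}}(M) \leq 2d-2$, $\; d-1 \leq \mathrm{rank}_{\mathbb{B}}(M) \leq 2d-2$, and $d-1 \leq i(M) \leq 2d-2$.
   Context: $\mathrm{rank}_{\mathbb{R}}(M)$ is the usual rank over $\mathbb{R}$. For a $0,1$ matrix $M$ of size $n\times m$, the binary rank $\mathrm{rank}_{\mathrm{bin}}(M)$ is the minimal $d$ for which there are $0,1$ matrices $A$ ($n\times d$) and $B$ ($d\times m$) with $M = A\cdot B$ over the integers; equivalently, the minimum number of all-one combinatorial rectangles (submatrices all of whose entries are $1$) needed to partition the ones of $M$. The Boolean rank $\mathrm{rank}_{\mathbb{B}}(M)$ is defined in the same way with Boolean arithmetic ($1+1=1$); equivalently, the minimum number of all-one combinatorial rectangles needed to cover the ones of $M$ (overlaps allowed). An isolation set of $M$ is a set of $1$-entries of $M$ such that no two of them are in the same row or column and no two of them belong to an all-one $2\times 2$ submatrix of $M$; $i(M)$ is the maximum size of an isolation set of $M$. *)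

(* Defs.v *)
From mathcomp Require Import all_boot all_order all_algebra.
From mathcomp Require Import reals.

Set Implicit Arguments.
Unset Strict Implicit.
Unset Printing Implicit Defensive.

Import GRing.Theory.
Local Open Scope ring_scope.

(* A 0,1 matrix is an ['M[bool]_(n, m)], with [true] for 1.  MathComp equips
   [bool] with the ring structure of the field with two elements, so [*m] and
   [\rank] must never be applied to such a matrix directly: [mx01 R M] is the
   same matrix with its entries 0 and 1 taken in [R]. *)
Definition mx01 (R : nzRingType) (n m : nat) (M : 'M[bool]_(n, m)) :
  'M[R]_(n, m) := \matrix_(i, j) (M i j)%:R.

Definition rank_real (R : realType) (n m : nat) (M : 'M[bool]_(n, m)) : nat :=
  \rank (mx01 R M).

Definition bin_factor (n m : nat) (M : 'M[bool]_(n, m)) (d : nat) : bool :=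
  [exists A : 'M[bool]_(n, d), exists B : 'M[bool]_(d, m),
     mx01 int M == mx01 int A *m mx01 int B].

Lemma bin_factor_ex (n m : nat) (M : 'M[bool]_(n, m)) :
  exists d, bin_factor M d.
Proof.
exists m; apply/existsP; exists M.
apply/existsP; exists (\matrix_(i, j) (i == j)); apply/eqP.
have -> : mx01 int (\matrix_(i < m, j < m) (i == j)) = 1%:M.
  by apply/matrixP => i j; rewrite !mxE.
by rewrite mulmx1.
Qed.

Definition rank_bin (n m : nat) (M : 'M[bool]_(n, m)) : nat :=
  ex_minn (bin_factor_ex M).

(* Matrix product over the Boolean semiring, in which 1 + 1 = 1. *)
Definition bool_mulmx (n d m : nat) (A : 'M[bool]_(n, d)) (B : 'M[bool]_(d, m)) :
  'M[bool]_(n, m) := \matrix_(i, j) \big[orb/false]_(k < d) (A i k && B k j).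

Definition bool_factor (n m : nat) (M : 'M[bool]_(n, m)) (d : nat) : bool :=
  [exists A : 'M[bool]_(n, d), exists B : 'M[bool]_(d, m),
     M == bool_mulmx A B].

Lemma bool_factor_ex (n m : nat) (M : 'M[bool]_(n, m)) :
  exists d, bool_factor M d.
Proof.
exists m; apply/existsP; exists M.
apply/existsP; exists (\matrix_(i, j) (i == j)); apply/eqP/matrixP => i j.
rewrite mxE big_orE; apply/idP/existsP => [Mij | [k]].
  by exists j; rewrite mxE eqxx andbT.
by rewrite mxE /= => /andP[Mik /eqP <-].
Qed.

Definition rank_bool (n m : nat) (M : 'M[bool]_(n, m)) : nat :=
  ex_minn (bool_factor_ex M).

(* The submatrix with row set [I] and column set [J] is all-one. *)
Definition all_one (n m : nat) (M : 'M[bool]_(n, m))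
  (I : {set 'I_n}) (J : {set 'I_m}) : bool :=
  [forall i in I, forall j in J, M i j].

Definition in_all_one_2x2 (n m : nat) (M : 'M[bool]_(n, m))
  (p q : 'I_n * 'I_m) : bool :=
  [exists I : {set 'I_n}, exists J : {set 'I_m},
     [&& #|I| == 2%N, #|J| == 2%N, all_one M I J,
         p \in setX I J & q \in setX I J]].

Definition isolation_set (n m : nat) (M : 'M[bool]_(n, m))
  (S : {set 'I_n * 'I_m}) : bool :=
  [forall p in S, M p.1 p.2] &&
  [forall p in S, forall q in S, (p != q) ==>
     [&& p.1 != q.1, p.2 != q.2 & ~~ in_all_one_2x2 M p q]].

Definition isolation_number (n m : nat) (M : 'M[bool]_(n, m)) : nat :=
  \max_(S : {set 'I_n * 'I_m} | isolation_set M S) #|S|.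

(* Main.v *)
Require Import Defs.
From mathcomp Require Import all_boot all_order all_algebra.
From mathcomp Require Import reals.
From mathcomp Require Import ring zify.

(** Four inequalities hold for every 0,1 matrix:
    i(M) <= rank_B(M) <= rank_bin(M) and rank_R(M) <= rank_bin(M).  It remains to
    show i(M) >= d - 1 and rank_bin(M) <= 2d - 2, and both reduce to finite checks.

    Choose [d] rows and [d] columns of [M] that cross in an invertible block [B].
    The row [i] of [M] is determined by its entries on the chosen columns, a
    point [x_i] of {0,1}^d.  By Cramer's rule the column [j] is determined by an
    integral linear form [a_j] such that [a_j(x_i) = D * M i j], where
    [D = |det B|] ([integral_coordinates]).  As 0,1 determinants of order 3
    and 4 are at most 2 and 3 in absolute value ([det_mx01_bound]), both [D] and
    the coefficients of [a_j] are at most [d - 1] in absolute value, so that only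
    finitely many configurations occur.

    Lower bound.  An isolation set of a submatrix is one of the whole matrix, so
    it is enough to look at [B].  Every set of at most [d] points of {0,1}^d, seen
    as the rows of a matrix, either has [d - 1] pairwise isolated ones or lies in
    a hyperplane with normal vector in {-1,0,1}^d ([isolable_all3],
    [isolable_all4]); the rows of an invertible block are of the first kind
    ([rank_isolation]).

    Upper bound.  Call a nonzero word of a set [S] of 0,1 words an atom if it is
    not the sum of two nonzero words of [S]; every word of [S] is a sum of
    distinct atoms ([atoms_sum]).  Let [X] be the set of all points of {0,1}^d on
    which each [a_j] takes a value in {0,D}.  It contains all [x_i], hence the
    atoms of [X] give the rows of the right factor of a factorization of [M]
    ([bin_factor_points]).  Dually, consider all integral forms that take only
    the values 0 and [D] on [X], as 0,1 words indexed by [X].  The columns of [M]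
    are restrictions of such words, whose atoms give a factorization too
    ([bin_factor_functionals]).  For all sets [X] of this kind one of the two
    families has at most [2d - 2] atoms; this is established by an exhaustive
    search ([search_all3], [search_all4]).  The search is small, because there is
    nothing to check when [X] has fewer than [2d] elements, 0 included, and few
    linear forms take only the values 0 and [D] on [2d] points. *)

Set Implicit Arguments.
Unset Strict Implicit.
Unset Printing Implicit Defensive.

Import Order.TTheory GRing.Theory Num.Theory.
Local Open Scope ring_scope.

(** * Inequalities valid for every 0,1 matrix *)

Section EasyBounds.
Variables (n m : nat) (M : 'M[bool]_(n, m)).

Lemma rank_real_le_bin (R : realType) : (rank_real R M <= rank_bin M)%N.
Proof.
rewrite /rank_bin; case: ex_minnP => k /existsP[A /existsP[B /eqP MAB]] _.
have -> : rank_real R M = \rank (map_mx intr (mx01 int M) : 'M[R]_(n, m)).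
  by congr mxrank; apply/matrixP => i j; rewrite !mxE; case: (M i j).
by rewrite MAB map_mxM mulmx_max_rank.
Qed.

Lemma bool_factor_bin k : bin_factor M k -> bool_factor M k.
Proof.
case/existsP=> A /existsP[B /eqP/matrixP MAB].
apply/existsP; exists A; apply/existsP; exists B.
apply/eqP/matrixP => i j; rewrite mxE big_orE.
have := MAB i j; rewrite !mxE.
under eq_bigr do rewrite !mxE -natrM mulnb.
rewrite -natr_sum => /eqP; rewrite eqr_nat => /eqP Mij.
have -> : M i j = (0 < M i j)%N by case: (M i j).
rewrite Mij; apply/idP/existsP => [|[k0 /= AB]].
  rewrite lt0n sum_nat_eq0 negb_forall => /existsP[k0 /=].
  by move=> nz; exists k0; case: (A i k0 && B k0 j) nz.
by rewrite (bigD1 k0) //= AB.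
Qed.

Lemma rank_bool_le_bin : (rank_bool M <= rank_bin M)%N.
Proof.
rewrite /rank_bin /rank_bool; case: (ex_minnP (bin_factor_ex M)) => k Mk _.
by case: ex_minnP => k' _; apply; apply: bool_factor_bin.
Qed.

(** Isolation is a symmetric relation which, between two ones of the matrix,
    already forces distinct rows and distinct columns. *)
Definition isolated (p q : 'I_n * 'I_m) := ~~ (M p.1 q.2 && M q.1 p.2).

Lemma isolation_setP (S : {set 'I_n * 'I_m}) :
  reflect ((forall p, p \in S -> M p.1 p.2) /\
           {in S &, forall p q, p != q -> isolated p q})
          (isolation_set M S).
Proof.
apply: (iffP andP) => [[/forall_inP S1 /forall_inP Sq]|[S1 Sq]]; split=> //.
- move=> p q pS qS pq; apply/negP => /andP[Mpq Mqp].
  have /forall_inP/(_ q qS)/implyP/(_ pq)/and3P[p1 p2 /negP[]] := Sq p pS.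
  apply/existsP; exists [set p.1; q.1]; apply/existsP; exists [set p.2; q.2].
  rewrite !cards2 p1 p2 !inE !eqxx !orbT !andbT /=.
  apply/forall_inP => i /set2P[]->; apply/forall_inP => j /set2P[]-> //.
    exact: S1.
  exact: S1.
- exact/forall_inP.
apply/forall_inP => p pS; apply/forall_inP => q qS; apply/implyP => pq.
have /negP iso := Sq p q pS qS pq.
apply/and3P; split.
- by apply/eqP => e; case: iso; rewrite e S1 //= -e S1.
- by apply/eqP => e; case: iso; rewrite -e S1 //= e S1.
apply/negP => /existsP[I /existsP[J /and5P[_ _ /forall_inP IJ]]].
rewrite !inE => /andP[pI pJ] /andP[qI qJ]; case: iso.
by rewrite (forall_inP (IJ _ pI)) // (forall_inP (IJ _ qI)).
Qed.

(** A rectangle of a Boolean factorization meets an isolation set in at most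
    one entry. *)
Lemma isolation_le_bool : (isolation_number M <= rank_bool M)%N.
Proof.
rewrite /rank_bool; case: ex_minnP => k /existsP[A /existsP[B /eqP MAB]] _.
have ME i j : M i j = [exists k0, A i k0 && B k0 j].
  by rewrite MAB mxE big_orE.
apply/bigmax_leqP => S /isolation_setP[S1 Siso].
have [S0|[p0 p0S]] := set_0Vmem S; first by rewrite S0 cards0.
have [k0 _] : exists k0, A p0.1 k0 && B k0 p0.2.
  by apply/existsP; rewrite -ME S1.
pose c (p : 'I_n * 'I_m) := odflt k0 [pick l | A p.1 l && B l p.2].
have cP p : p \in S -> A p.1 (c p) && B (c p) p.2.
  move=> /S1; rewrite ME /c => /existsP[l ABl].
  by case: pickP => [//|/(_ l)]; rewrite ABl.
rewrite -[k]card_ord -(card_in_imset (f := c)) ?max_card // => p q pS qS cpq.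
apply/eqP/negPn/negP => /(Siso p q pS qS)/negP; apply.
have /andP[Ap Bp] := cP p pS; have /andP[Aq Bq] := cP q qS.
by rewrite !ME; apply/andP; split; apply/existsP; exists (c p);
   rewrite ?Ap ?Bp ?cpq ?Aq ?Bq.
Qed.

End EasyBounds.

Lemma bin_factor_tr n m (M : 'M[bool]_(n, m)) k :
  bin_factor M^T k -> bin_factor M k.
Proof.
case/existsP=> A /existsP[B /eqP MAB].
apply/existsP; exists B^T; apply/existsP; exists A^T; apply/eqP.
have tr p q (N : 'M[bool]_(p, q)) : mx01 int N^T = (mx01 int N)^T.
  by apply/matrixP => i j; rewrite !mxE.
by rewrite !tr -trmx_mul -MAB tr trmxK.
Qed.

(** The left factor records which elements of [s] are summed in each row; this
    is how families of atoms below are turned into factorizations. *)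
Lemma bin_factor_sums n m (M : 'M[bool]_(n, m)) (T : Type) (s : seq T)
    (w : T -> 'I_m -> bool) (P : 'I_n -> pred T) :
  (forall i j, M i j = (\sum_(t <- s | P i t) w t j)%N :> nat) ->
  bin_factor M (size s).
Proof.
move=> Ms; apply/existsP; exists (\matrix_(i, k) P i (tnth (in_tuple s) k)).
apply/existsP; exists (\matrix_(k, j) w (tnth (in_tuple s) k) j).
apply/eqP/matrixP => i j; rewrite !mxE Ms big_tnth big_mkcond natr_sum.
apply: eq_bigr => k _; rewrite !mxE.
by case: (P i _); rewrite ?mul1r ?mul0r.
Qed.

(** * Words and linear forms *)

Fixpoint words (T : Type) (s : seq T) (d : nat) : seq (seq T) :=
  if d is d'.+1 then [seq c :: w | c <- s, w <- words s d'] else [:: [::]].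

Lemma mem_words (T : eqType) (s : seq T) d w :
  (w \in words s d) = (size w == d) && all (mem s) w.
Proof.
elim: d w => [|d IHd] [|c w] //=.
  by apply/negbTE/allpairsP => -[[c w] []].
rewrite eqSS andbCA -IHd; apply/allpairsP/andP => [[[c' w'] [? ? [-> ->]]]|[? ?]] //.
by exists (c, w).
Qed.

Lemma words_uniq (T : eqType) (s : seq T) d : uniq s -> uniq (words s d).
Proof.
move=> s_uniq; elim: d => //= d IHd.
by apply: allpairs_uniq => // -[c w] [c' w'] _ _ [-> ->].
Qed.

Definition points d := words [:: false; true] d.

Lemma mem_points d x : (x \in points d) = (size x == d).
Proof. by rewrite mem_words; case: eqP => //= _; apply/allP => -[]. Qed.

Definition word n (T : Type) (u : 'I_n -> T) := [seq u k | k <- enum 'I_n].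

Lemma size_word n T (u : 'I_n -> T) : size (word u) = n.
Proof. by rewrite size_map size_enum_ord. Qed.

Lemma nth_word n T (x0 : T) (u : 'I_n -> T) (k : 'I_n) : nth x0 (word u) k = u k.
Proof. by rewrite (nth_map k) ?size_enum_ord // nth_ord_enum. Qed.

Lemma word_nth n T (x0 : T) w : size w = n -> word (fun k : 'I_n => nth x0 w k) = w.
Proof.
move=> sw; apply: (@eq_from_nth _ x0) => [|k]; rewrite size_word ?sw // => kn.
by rewrite -[k]/(val (Ordinal kn)) nth_word.
Qed.

(** The value at a 0,1 point of the linear form with coefficient vector [a]. *)
Fixpoint eval (a : seq int) (x : seq bool) : int :=
  if a is c :: a' then
    if x is b :: x' then (if b then c + eval a' x' else eval a' x') else 0
  else 0.

Lemma eval_sum a x :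
  eval a x = \sum_(k < size a) (nth false x k)%:R * a`_k.
Proof.
elim: a x => [|c a IHa] x; first by rewrite big_ord0.
case: x => [|b x].
  by rewrite big1 //= => k _; rewrite nth_nil mul0r.
by rewrite big_ord_recl /= -IHa; case: b; rewrite ?mul1r ?mul0r ?add0r.
Qed.

Lemma eval_word d (c : 'I_d -> int) (x : 'I_d -> bool) :
  eval (word c) (word x) = \sum_k (x k)%:R * c k.
Proof.
rewrite -big_enum /word; elim: (enum 'I_d) => [|k s IHs] /=.
  by rewrite big_nil.
by rewrite big_cons IHs; case: (x k); rewrite ?mul1r ?mul0r ?add0r.
Qed.

(** Normal vectors with entries in {-1,0,1} do not detect every set of points
    that fails to span, but they suffice for the two finite checks, and for
    soundness any normal vector will do. *)
Definition degenerate d (X : seq (seq bool)) :=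
  has (fun v => has (fun c => c != 0) v && all (fun x => eval v x == 0) X)
      (words [:: -1; 0; 1 : int] d).

Lemma det_nondegenerate d (B : 'M[bool]_d) X :
  \det (mx01 int B) != 0 -> (forall i, word (B i) \in X) -> ~~ degenerate d X.
Proof.
move=> detB BX; apply/hasP => -[v]; rewrite mem_words.
case/andP=> /eqP sv _ /andP[/hasP[c vc c0] /allP vX].
pose u : 'cV[int]_d := \col_k v`_k.
have Bu : mx01 int B *m u = 0.
  apply/matrixP => i j; rewrite !mxE.
  have /eqP := vX _ (BX i); rewrite -[v](word_nth 0 sv) eval_word => v0.
  by rewrite -[RHS]v0; apply: eq_bigr => k _; rewrite !mxE.
have /eqP : \det (mx01 int B) *: u = 0.
  by rewrite -mul_scalar_mx -mul_adj_mx -mulmxA Bu mulmx0.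
rewrite scalemx_eq0 (negbTE detB) /= => /eqP u0.
have kd : (index c v < d)%N by rewrite -sv index_mem.
have /colP/(_ (Ordinal kd)) := u0; rewrite !mxE /= nth_index //.
exact/eqP.
Qed.

(** * Determinants of 0,1 matrices of order 3 and 4 *)

(** Expansion along the first row, with entries indexed by natural numbers so
    that it unfolds to a polynomial for a numeral [n]. *)
Fixpoint laplace (R : comPzRingType) n (F : nat -> nat -> R) : R :=
  if n is n'.+1 then
    \sum_(k < n) (-1) ^+ k * F 0 k *
      laplace n' (fun i j => F i.+1 (bump k j))
  else 1.

Lemma det_laplace (R : comPzRingType) n (F : nat -> nat -> R) :
  \det (\matrix_(i < n, j < n) F i j) = laplace n F.
Proof.
elim: n F => [|n IHn] F /=; first by rewrite det_mx00.
rewrite (expand_det_row _ ord0); apply: eq_bigr => k _.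
rewrite mxE mulrCA mulrA -IHn; congr (_ * _ * \det _).
by apply/matrixP => i j; rewrite !mxE.
Qed.

(** The 2 x 2 minors of a pair of rows of length 4.  A determinant of order 4
    is bilinear in the minors of its two halves, and these take few values: the
    bound below runs over pairs of minor vectors instead of all 2^16 matrices. *)
Definition row_pair_minors (r s : seq bool) : seq int :=
  [seq (nth false r p.1 && nth false s p.2)%:R -
       (nth false r p.2 && nth false s p.1)%:R
     | p <- [:: (0, 1); (0, 2); (0, 3); (1, 2); (1, 3); (2, 3)]%N].

(** Laplace expansion along two rows. *)
Definition pairing (p q : seq int) : int :=
  p`_0 * q`_5 - p`_1 * q`_4 + p`_2 * q`_3 +
  p`_3 * q`_2 - p`_4 * q`_1 + p`_5 * q`_0.

Lemma pairing_minors_bound :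
  let W := undup [seq row_pair_minors r s | r <- points 4, s <- points 4] in
  all (fun p => all (fun q => `|pairing p q| <= 3) W) W.
Proof. by vm_compute. Qed.

Definition det3 (r s t : seq bool) : int :=
  let m i j : int := (nth false s i && nth false t j)%:R -
                     (nth false s j && nth false t i)%:R in
  (nth false r 0)%:R * m 1%N 2%N - (nth false r 1)%:R * m 0%N 2%N +
  (nth false r 2)%:R * m 0%N 1%N.

Lemma det3_bound :
  all (fun r => all (fun s => all (fun t => `|det3 r s t| <= 2) (points 3))
                    (points 3)) (points 3).
Proof. by vm_compute. Qed.

Lemma det_mx01_words d (B : 'M[bool]_d.+1) :
  exists r : nat -> seq bool, (forall i, r i \in points d.+1) /\
    \det (mx01 int B) = laplace d.+1 (fun i j => (nth false (r i) j)%:R).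
Proof.
exists (fun i => mkseq (fun j => B (inord i) (inord j)) d.+1); split.
  by move=> i; rewrite mem_points size_mkseq.
rewrite -det_laplace; congr (\det _); apply/matrixP => i j.
by rewrite !mxE nth_mkseq // !inord_val.
Qed.

Lemma det_mx01_le2 (B : 'M[bool]_3) : `|\det (mx01 int B)| <= 2.
Proof.
have [r [r_in ->]] := det_mx01_words B.
suff -> : laplace 3 (fun i j => (nth false (r i) j)%:R) =
          det3 (r 0%N) (r 1%N) (r 2%N) :> int.
  have /allP/(_ _ (r_in 0%N))/allP/(_ _ (r_in 1%N))/allP := det3_bound.
  exact.
rewrite /det3 -!mulnb !natrM /= !big_ord_recl !big_ord0 /= /bump /=.
by rewrite !(addn0, add0n, add1n); ring.
Qed.

Lemma det_mx01_le3 (B : 'M[bool]_4) : `|\det (mx01 int B)| <= 3.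
Proof.
have [r [r_in ->]] := det_mx01_words B.
suff -> : laplace 4 (fun i j => (nth false (r i) j)%:R) =
          pairing (row_pair_minors (r 0%N) (r 1%N)) (row_pair_minors (r 2%N) (r 3%N)) :> int.
  have /allP := pairing_minors_bound; move=> /(_ (row_pair_minors (r 0%N) (r 1%N))).
  rewrite mem_undup allpairs_f // => /(_ isT)/allP; apply.
  by rewrite mem_undup allpairs_f.
rewrite /pairing /= -!mulnb !natrM /= !big_ord_recl !big_ord0 /= /bump /=.
by rewrite !(addn0, add0n, add1n); ring.
Qed.

Lemma det_mx01_bound d (B : 'M[bool]_d) :
  d = 3%N \/ d = 4%N -> `|\det (mx01 int B)| <= d.-1%:Z.
Proof. by case=> d_eq; subst d; [apply: det_mx01_le2 | apply: det_mx01_le3]. Qed.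

(** * Integral coordinates of the rows and the columns *)

Lemma unit_submatrix (F : fieldType) n m d (A : 'M[F]_(n, m)) :
  \rank A = d ->
  exists (f : 'I_d -> 'I_n) (g : 'I_d -> 'I_m), mxsub f g A \in unitmx.
Proof.
move=> <-; pose A1 := rowsub (maxrankfun A) A.
have full1 : row_full A1^T by rewrite /row_full mxrank_tr; exact: maxrowsub_free.
exists (maxrankfun A), (fullrankfun full1).
rewrite -unitmx_tr.
have -> : (mxsub (maxrankfun A) (fullrankfun full1) A)^T =
          rowsub (fullrankfun full1) A1^T.
  by apply/matrixP => i j; rewrite !mxE.
exact: fullrowsub_unit.
Qed.

(** Every row of [A] is a combination of the rows [f], with coefficients that
    can be read off on the columns [g], where the rows [f] form [B]. *)
Lemma cross_decomposition (F : fieldType) n m d (A : 'M[F]_(n, m))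
    (f : 'I_d -> 'I_n) (g : 'I_d -> 'I_m) (B := mxsub f g A) :
  \rank A = d -> B \in unitmx ->
  \det B *: A = colsub g A *m (\adj B *m rowsub f A).
Proof.
move=> rA uB.
have sub : (rowsub f A <= A)%MS by rewrite rowsubE submxMl.
have BE : B = colsub g (rowsub f A) by rewrite /B mxsubcr.
have : (A <= rowsub f A)%MS.
  rewrite -(geq_leqif (mxrank_leqif_sup sub)) rA.
  move: uB; rewrite -row_free_unit => /eqP {1}<-.
  by rewrite BE -{1}(mulmx1 (rowsub f A)) -mulmx_colsub mxrankM_maxl.
case/submxP => E AE.
have EB : colsub g A = E *m B by rewrite {1}AE -mulmx_colsub -BE.
by rewrite EB mulmxA -(mulmxA E) mul_mx_adj mul_mx_scalar -scalemxAl -AE.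
Qed.

Lemma integral_cross_decomposition (R : realType) n m d (M : 'M[bool]_(n, m)) :
  rank_real R M = d ->
  exists (f : 'I_d -> 'I_n) (g : 'I_d -> 'I_m),
    let B := mx01 int (mxsub f g M) in
    \det B != 0 /\
    \det B *: mx01 int M =
      colsub g (mx01 int M) *m (\adj B *m rowsub f (mx01 int M)).
Proof.
move=> rM; have [f [g uB]] := unit_submatrix rM; exists f, g => B.
have RM p q (N : 'M[bool]_(p, q)) : mx01 R N = map_mx intr (mx01 int N).
  by apply/matrixP => i j; rewrite !mxE; case: (N i j).
have BE : mxsub f g (mx01 R M) = map_mx intr B.
  by apply/matrixP => i j; rewrite !mxE; case: (M _ _).
have := cross_decomposition rM uB; rewrite BE RM det_map_mx -map_mx_adj.
rewrite -map_mxsub -map_mxsub -!map_mxM -map_mxZ => dec.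
split; first by move: uB; rewrite BE unitmxE det_map_mx unitfE intr_eq0.
apply/matrixP => i j; apply: (@intr_inj R).
by have /matrixP/(_ i j) := dec; rewrite !mxE.
Qed.

Definition coef_range d : seq int := [seq k%:Z - d.-1%:Z | k <- iota 0 (2 * d.-1).+1].

Lemma mem_coef_range d (c : int) : `|c| <= d.-1%:Z -> c \in coef_range d.
Proof.
move=> cd; apply/mapP; exists (absz (c + d.-1%:Z)); last by lia.
by rewrite mem_iota; lia.
Qed.

(** The numerators in Cramer's rule. *)
Lemma adj_mul_det (R : comPzRingType) d (B : 'M[R]_d) (y : 'cV[R]_d) k :
  (\adj B *m y) k 0 = \det (\matrix_(i, l) if l == k then y i 0 else B i l).
Proof.
rewrite (expand_det_col _ k) mxE; apply: eq_bigr => i _.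
rewrite !mxE eqxx mulrC; congr (_ * (_ * \det _)).
by apply/matrixP => r c; rewrite !mxE eq_sym (negbTE (neq_lift _ _)).
Qed.

(** The sign of [det B] is moved into the forms [a j], which makes [D]
    positive.  Each coefficient of [a j] is, up to sign, the determinant of a 0,1
    matrix: the block with one column replaced by a column of [M]. *)
Lemma integral_coordinates (R : realType) n m d (M : 'M[bool]_(n, m)) :
  d = 3%N \/ d = 4%N -> rank_real R M = d ->
  exists (f : 'I_d -> 'I_n) (g : 'I_d -> 'I_m) (D : nat) (a : 'I_m -> seq int),
  [/\ \det (mx01 int (mxsub f g M)) != 0, (0 < D < d)%N,
      forall j, a j \in words (coef_range d) d
    & forall i j, eval (a j) (word (fun k => M i (g k))) = D%:Z * (M i j)%:R].
Proof.
move=> hd /integral_cross_decomposition[f [g]].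
set B := mx01 int _ => -[detB dec].
pose P := \adj B *m rowsub f (mx01 int M).
have detd := det_mx01_bound (mxsub f g M) hd; rewrite -/B in detd.
exists f, g, (absz (\det B)), (fun j => word (fun k => sgz (\det B) * P k j)).
split=> // [|j|i j].
- have d_gt0 : (0 < d)%N by case: hd => ->.
  by rewrite absz_gt0 detB -ltz_nat abszE (le_lt_trans detd) // ltz_nat ltn_predL.
- rewrite mem_words size_word eqxx; apply/allP => _ /mapP[k _ ->].
  apply: mem_coef_range; rewrite normrM normr_sgz detB mul1r.
  pose B' : 'M[bool]_d := \matrix_(i, l) if l == k then M (f i) j else M (f i) (g l).
  have -> : P k j = \det (mx01 int B').
    transitivity ((\adj B *m col j (rowsub f (mx01 int M))) k 0).
      by rewrite !mxE; apply: eq_bigr => l _; rewrite !mxE.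
    rewrite adj_mul_det; congr (\det _); apply/matrixP => i l; rewrite !mxE.
    by case: eqP.
  exact: det_mx01_bound.
rewrite eval_word abszEsg -mulrA.
have /matrixP/(_ i j) := dec; rewrite !mxE => ->; rewrite mulr_sumr.
by apply: eq_bigr => k _; rewrite !mxE mulrCA.
Qed.

(** * The lower bound for the isolation number *)

(** An entry is a row, given as a word, paired with a column.  An entry
    holding a 1 is not compatible with itself, so a family of pairwise compatible
    ones needs no separate test of distinctness. *)
Definition compat (e e' : seq bool * nat) :=
  ~~ (nth false e.1 e'.2 && nth false e'.1 e.2).

Fixpoint isolable k (E : seq (seq bool * nat)) :=
  if k is k'.+1 then has (fun e => isolable k' [seq e' <- E | compat e e']) E
  else true.

(** The words may be repeated or in any order: [phi] only has to preserve the
    values at pairs of entries of [E]. *)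
Lemma isolable_isolation n m (M : 'M[bool]_(n, m))
    (phi : seq bool * nat -> 'I_n * 'I_m) E k :
  (forall e, e \in E -> nth false e.1 e.2) ->
  {in E &, forall e e', M (phi e).1 (phi e').2 = nth false e.1 e'.2} ->
  isolable k E ->
  exists S : {set 'I_n * 'I_m}, [/\ isolation_set M S, #|S| = k
    & forall p, p \in S -> exists2 e, e \in E & p = phi e].
Proof.
elim: k E => [|k IHk] E E1 phiE /=.
  exists set0; split; rewrite ?cards0 //; last by move=> p; rewrite inE.
  by apply/isolation_setP; split=> p; rewrite inE.
case/hasP=> e eE /IHk[||S [/isolation_setP[S1 Siso] Sk SE]].
- by move=> e'; rewrite mem_filter => /andP[_ /E1].
- by move=> e1 e2; rewrite !mem_filter => /andP[_ ?] /andP[_ ?]; exact: phiE.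
have iso_e p : p \in S -> isolated M (phi e) p.
  case/SE=> e'; rewrite mem_filter => /andP[cee' e'E] ->.
  by rewrite /isolated !phiE.
have Me : M (phi e).1 (phi e).2 by rewrite phiE ?E1.
have eS : phi e \notin S.
  by apply/negP => /iso_e; rewrite /isolated Me.
exists (phi e |: S); split.
- apply/isolation_setP; split=> [p /setU1P[->|/S1]//|p q].
  move=> /setU1P[->|pS] /setU1P[->|qS]; rewrite ?eqxx // => pq.
  + exact: iso_e.
  + by rewrite /isolated andbC; exact: iso_e.
  + exact: Siso.
- by rewrite cardsU1 eS Sk.
move=> p /setU1P[->|/SE[e']]; first by exists e.
by rewrite mem_filter => /andP[_ e'E] ->; exists e'.
Qed.

Definition ones d (X : seq (seq bool)) :=
  [seq e <- [seq (x, i) | x <- X, i <- iota 0 d] | nth false e.1 e.2].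

Fixpoint small_sublists (T : Type) k (l : seq T) : seq (seq T) :=
  if l is x :: l' then
    small_sublists k l' ++
    (if k is k'.+1 then [seq x :: s | s <- small_sublists k' l'] else [::])
  else [:: [::]].

Lemma mem_small_sublists (T : eqType) k (l : seq T) (p : pred T) :
  (count p l <= k)%N -> filter p l \in small_sublists k l.
Proof.
elim: l k => //= x l IHl k; rewrite mem_cat; case: (p x) => /= pk.
  by case: k pk => // k pk; rewrite map_f ?orbT // IHl.
by rewrite IHl.
Qed.

(* [if] instead of [||], here and in the search below: under call by value the
   boolean connectives evaluate both of their arguments. *)
Definition isolable_all d :=
  all (fun X => if isolable d.-1 (ones d X) then true else degenerate d X)
      (small_sublists d (points d)).

Lemma isolable_all3 : isolable_all 3. Proof. by vm_compute. Qed.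
Lemma isolable_all4 : isolable_all 4. Proof. by vm_compute. Qed.

(** The finite check runs over sorted lists without repetition; [X'] is the
    one with the same elements as [X]. *)
Lemma nondegenerate_isolable d (X : seq (seq bool)) :
  isolable_all d -> {subset X <= points d} -> (size X <= d)%N ->
  ~~ degenerate d X -> exists2 X', X' =i X & isolable d.-1 (ones d X').
Proof.
move=> /allP iso_all Xd sX nX; pose X' := [seq x <- points d | x \in X].
have X'X : X' =i X.
  by move=> x; rewrite mem_filter; case xX : (x \in X) => //=; rewrite Xd.
exists X' => //; suff /iso_all : X' \in small_sublists d (points d).
  case: isolable => // /hasP[v v_in /andP[v0 vX]]; case/hasP: nX.
  by exists v => //; rewrite v0 -(eq_all_r X'X).
apply: mem_small_sublists; rewrite -size_filter; apply: leq_trans sX.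
apply: uniq_leq_size => [|x]; last by rewrite X'X.
by rewrite filter_uniq // words_uniq.
Qed.

Lemma rank_isolation (R : realType) n m d (M : 'M[bool]_(n, m)) :
  d = 3%N \/ d = 4%N -> rank_real R M = d ->
  (d - 1 <= isolation_number M)%N.
Proof.
move=> hd /integral_cross_decomposition[f [g [detB _]]].
have iso_d : isolable_all d.
  by case: hd => ->; [apply: isolable_all3 | apply: isolable_all4].
have d_gt0 : (0 < d)%N by case: hd => ->.
pose w i : seq bool := word (fun k => M (f i) (g k)).
pose X := [seq w i | i <- enum 'I_d].
have Xd : {subset X <= points d}.
  by move=> _ /mapP[i _ ->]; rewrite mem_points size_word.
have nX : ~~ degenerate d X.
  apply: det_nondegenerate detB _ => i.
  have -> : word (mxsub f g M i) = w i by apply: eq_map => k; rewrite mxE.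
  by rewrite map_f ?mem_enum.
have [|X' X'X iso_X'] := nondegenerate_isolable iso_d Xd _ nX.
  by rewrite size_map size_enum_ord.
pose i0 := Ordinal d_gt0.
pose phi e := (f (odflt i0 [pick i | w i == e.1]), g (insubd i0 e.2)).
have onesE e : e \in ones d X' ->
    [/\ (e.2 < d)%N, nth false e.1 e.2 & w (odflt i0 [pick i | w i == e.1]) = e.1].
  rewrite mem_filter => /andP[e1 /allpairsP[[x i] /= [xX' + e_eq]]].
  move: e1; rewrite {}e_eq /= => xi; rewrite mem_iota /= => id; split=> //.
  case: pickP => [i' /eqP //|w_x].
  by move: xX'; rewrite X'X => /mapP[i' _ x_eq]; have := w_x i'; rewrite x_eq eqxx.
have [||S [isoS cardS _]] := isolable_isolation (M := M) (phi := phi) _ _ iso_X'.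
- by move=> e /onesE[].
- move=> e e' /onesE[_ _ we] /onesE[e'd _ _].
  rewrite -[in RHS]we /phi /= /w.
  have {2}-> : e'.2 = insubd i0 e'.2 :> nat by rewrite val_insubd e'd.
  by rewrite nth_word.
by rewrite subn1 -cardS; exact: leq_bigmax_cond.
Qed.

(** * Decomposition into atoms *)

(** The complement of [t] in [s], meant for [t] below [s]. *)
Definition word_diff (s t : seq bool) := [seq p.1 && ~~ p.2 | p <- zip s t].

Definition splits (S : seq (seq bool)) s :=
  has (fun t => [&& has id t, t != s, all2 implb t s & word_diff s t \in S]) S.

Definition atoms (S : seq (seq bool)) :=
  [seq s <- undup S | has id s & ~~ splits S s].

Lemma nth_word_diff s t k : all2 implb t s ->
  (nth false t k + nth false (word_diff s t) k = nth false s k)%N.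
Proof.
rewrite /word_diff; elim: t s k => [|b t IHt] [|c s] [|k] //= /andP[bc ts].
  by case: b c bc => [] [].
exact: IHt.
Qed.

Lemma count_word_diff s t : all2 implb t s ->
  (count id t + count id (word_diff s t) = count id s)%N.
Proof.
rewrite /word_diff; elim: t s => [|b t IHt] [|c s] //= /andP[bc /IHt <-].
by case: b c bc => [] [] //= _; lia.
Qed.

Lemma has_word_diff s t : all2 implb t s -> t != s -> has id (word_diff s t).
Proof.
rewrite /word_diff; elim: t s => [|b t IHt] [|c s] //= /andP[bc ts].
by case: b c bc => [] [] //= _; rewrite eqseq_cons /= => /(IHt _ ts).
Qed.

Lemma atoms_uniq S : uniq (atoms S).
Proof. by rewrite filter_uniq ?undup_uniq. Qed.

Lemma mem_atoms S s : s \in atoms S -> s \in S.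
Proof. by rewrite mem_filter mem_undup => /andP[]. Qed.

(** By induction on the number of ones.  The atoms in a sum are distinct: two
    copies of one atom would add up to 2 at each of its ones. *)
Lemma atoms_sum S s : s \in S ->
  exists P : pred (seq bool), forall k,
    nth false s k = (\sum_(t <- atoms S | P t) nth false t k)%N :> nat.
Proof.
have [c] := ubnP (count id s); elim: c s => // c IHc s; rewrite ltnS => sc sS.
have [s0|/hasPn s0] := boolP (has id s); last first.
  exists pred0 => k; rewrite big_pred0_eq; apply/eqP; rewrite eqb0.
  have [k_lt|k_ge] := ltnP k (size s); last by rewrite nth_default.
  exact/s0/mem_nth.
have [/hasP[t tS /and4P[t0 ts ts_le rS]]|irr] := boolP (splits S s); last first.
  exists (pred1 s) => k; rewrite -big_filter.
  have -> : [seq t <- atoms S | pred1 s t] = [:: s].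
    apply: perm_small_eq => //; rewrite filter_pred1_uniq ?atoms_uniq //.
    by rewrite mem_filter mem_undup s0 irr sS.
  by rewrite big_seq1.
have := count_word_diff ts_le; have := has_word_diff ts_le ts.
move: t0; rewrite !has_count => t0 r0 tr.
have [|Pt tE] := IHc t _ tS; first by lia.
have [|Pr rE] := IHc _ _ rS; first by lia.
(* [Pt] and [Pr] have no atom in common, since [t] and its complement in [s] have
   no common one. *)
exists (predU Pt Pr) => k; rewrite -(nth_word_diff k ts_le) tE rE.
rewrite big_mkcond [X in (_ + X)%N = _]big_mkcond [RHS]big_mkcond -big_split /=.
rewrite !big_seq.
apply: eq_bigr => q qS; case Ptq: (Pt q); case Prq: (Pr q); rewrite ?addn0 //=.
have [k0 k0q] : exists k0, nth false q k0.
  move: qS; rewrite mem_filter => /andP[/andP[/hasP[b bq b1] _] _].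
  by exists (index b q); rewrite nth_index.
have le1 : (nth false t k0 + nth false (word_diff s t) k0 <= 1)%N.
  by rewrite nth_word_diff //; case: nth.
have sum_pos (P : pred (seq bool)) : P q ->
    (0 < \sum_(t' <- atoms S | P t') nth false t' k0)%N.
  by move=> Pq; rewrite (big_rem q) //= Pq k0q.
have := leq_add (sum_pos _ Ptq) (sum_pos _ Prq).
by rewrite -tE -rE => /leq_trans/(_ le1).
Qed.

(** * The search for sets of points with many atoms *)

Definition fits (D : int) (a : seq int) (x : seq bool) :=
  (eval a x == 0) || (eval a x == D).

(** Only forms that can contribute to a set of at least [2 * d] points are kept.
    Those that fit a degenerate set alone are discarded: there are
    many of them, such as [2 * (x_0 - x_1)] for odd [D], whereas the points that
    come from a matrix of rank [d] span the space. *)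
Definition functionals d D :=
  [seq a <- words (coef_range d) d |
     let X := [seq x <- points d | fits D a x] in
     if (2 * d <= size X)%N then ~~ degenerate d X else false].

Definition value_words D (L : seq (seq int)) (X : seq (seq bool)) :=
  [seq [seq eval a x == D | x <- X] | a <- [seq a <- L | all (fits D a) X]].

Definition few_atoms d D L X :=
  if (size (atoms X) <= 2 * d - 2)%N then true else
  (size (atoms (value_words D L X)) <= 2 * d - 2)%N.

(** Decides for each form of [l] whether it is imposed on [X].  A form that
    fits all of [X] changes nothing, and a set of fewer than [2 * d] points has at
    most [2 * d - 2] atoms, as it contains 0. *)
Fixpoint search d D L X l :=
  if l is a :: l' then
    let X' := [seq x <- X | fits D a x] in
    if search d D L X l' then
      if (size X' < 2 * d)%N then true else
      if all (fits D a) X then true else search d D L X' l'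
    else false
  else few_atoms d D L X.

Definition joint_fit D (L : seq (seq int)) X :=
  [seq x <- X | all (fun a => fits D a x) L].

Lemma search_sound d D L X l (P : pred (seq int)) :
  search d D L X l -> (2 * d <= size (joint_fit D (filter P l) X))%N ->
  few_atoms d D L (joint_fit D (filter P l) X).
Proof.
rewrite /joint_fit; elim: l X => [|a l IHl] X /=.
  by rewrite filter_predT.
case: ifP => // skip take; case: (P a) => /=; last exact: IHl.
rewrite filter_predI; set X' := filter (fits D a) X.
have -> : [seq x <- [seq x <- X | all (fits D ^~ x) (filter P l)] | fits D a x] =
          [seq x <- X' | all (fits D ^~ x) (filter P l)].
  by rewrite /X' -!filter_predI; apply: eq_filter => x /=; rewrite andbC.
move: take; case: ifP => [X'_small _|_].
  by rewrite leqNgt (leq_ltn_trans _ X'_small) // size_filter count_size.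
case: ifP => [/all_filterP X'X _|_]; last exact: IHl.
by rewrite /X' X'X; exact: IHl.
Qed.

Definition search_all d :=
  all (fun D : nat => let L := functionals d D%:Z in
                search d D%:Z L (points d) L) (iota 1 d.-1).

Lemma search_all3 : search_all 3. Proof. by vm_compute. Qed.
Lemma search_all4 : search_all 4. Proof. by vm_compute. Qed.

(** * The upper bound for the binary rank *)

Section UpperBound.
Variables (n m d D : nat) (M : 'M[bool]_(n, m)).
Variables (x : 'I_n -> seq bool) (a : 'I_m -> seq int) (X : seq (seq bool)).
Hypothesis D_gt0 : (0 < D)%N.
Hypothesis eval_ax : forall i j, eval (a j) (x i) = D%:Z * (M i j)%:R.
Hypothesis xX : forall i, x i \in X.

Lemma eval_eqD i j : (eval (a j) (x i) == D%:Z) = M i j.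
Proof.
rewrite eval_ax; case: (M i j); rewrite ?mulr1 ?eqxx // mulr0 eq_sym.
by rewrite eqz_nat eqn0Ngt D_gt0.
Qed.

(** A linear form maps a decomposition of [x i] into atoms to one of the entry
    [M i j], because its value on an atom is either 0 or [D]. *)
Lemma bin_factor_points :
  (forall j, all (fits D%:Z (a j)) X) -> bin_factor M (size (atoms X)).
Proof.
move=> aX; have D0 : D%:Z != 0 by rewrite eqz_nat -lt0n.
have /fin_all_exists[P PE] := fun i => atoms_sum (xX i).
apply: (bin_factor_sums (w := fun t j => eval (a j) t == D%:Z) (P := P)) => i j.
apply/eqP; rewrite -(eqr_nat int) natr_sum; apply/eqP/(mulfI D0).
rewrite -eval_ax eval_sum.
under [LHS]eq_bigr do rewrite PE natr_sum mulr_suml.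
rewrite exchange_big mulr_sumr /= big_seq_cond [RHS]big_seq_cond.
apply: eq_bigr => t /andP[/mem_atoms tX _]; rewrite -eval_sum.
case/orP: (allP (aX j) t tX) => /eqP->; last by rewrite eqxx mulr1.
by rewrite eq_sym (negbTE D0) mulr0.
Qed.

Lemma bin_factor_functionals L :
  (forall j, a j \in L) -> (forall j, all (fits D%:Z (a j)) X) ->
  bin_factor M (size (atoms (value_words D%:Z L X))).
Proof.
move=> aL aX; apply: bin_factor_tr.
have aV j : [seq eval (a j) y == D%:Z | y <- X] \in value_words D%:Z L X.
  apply: (map_f (fun b => [seq eval b y == D%:Z | y <- X])).
  by rewrite mem_filter aX aL.
have /fin_all_exists[P PE] := fun j => atoms_sum (aV j).
apply: (bin_factor_sums (w := fun t i => nth false t (index (x i) X)) (P := P)).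
move=> j i; rewrite -PE (nth_map (x i)) ?index_mem // nth_index //.
by rewrite eval_eqD mxE.
Qed.

End UpperBound.

Lemma rank_bin_upper (R : realType) n m d (M : 'M[bool]_(n, m)) :
  d = 3%N \/ d = 4%N -> rank_real R M = d -> (rank_bin M <= 2 * d - 2)%N.
Proof.
move=> hd /(integral_coordinates hd)[f [g [D [a [detB /andP[D_gt0 Dd] a_coef aE]]]]].
have bin_le k : bin_factor M k -> (k <= 2 * d - 2)%N -> (rank_bin M <= 2 * d - 2)%N.
  by rewrite /rank_bin; case: ex_minnP => k' _ k'_min /k'_min; exact: leq_trans.
pose x i := word (fun k => M i (g k)).
pose X := joint_fit D%:Z [seq a j | j <- enum 'I_m] (points d).
have xX i : x i \in X.
  rewrite mem_filter mem_points size_word eqxx andbT.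
  apply/allP => _ /mapP[j _ ->]; rewrite /fits aE.
  by case: (M i j); rewrite ?mulr1 ?mulr0 eqxx ?orbT.
have aX j : all (fits D%:Z (a j)) X.
  apply/allP => y; rewrite mem_filter => /andP[/allP aY _].
  by apply: aY; rewrite map_f ?mem_enum.
have [X_small|X_large] := ltnP (size X) (2 * d).
  apply: bin_le (bin_factor_points D_gt0 aE xX aX) _.
  pose zero := nseq d false.
  have zeroX : zero \in X.
    rewrite mem_filter mem_points size_nseq eqxx andbT.
    apply/allP => b _; rewrite /fits eval_sum big1 // => k _.
    by rewrite nth_nseq if_same mul0r.
  suff : (size (zero :: atoms X) <= size X)%N by move=> /=; lia.
  apply: uniq_leq_size => [|y]; rewrite ?inE; last first.
    by case/predU1P=> [->|/mem_atoms].
  rewrite /= atoms_uniq andbT mem_filter; apply/negP => /andP[/andP[zero1 _] _].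
  by rewrite has_nseq andbF in zero1.
pose L := functionals d D%:Z.
(* The forms of [M] survive the filters, as they all fit the large set [X], which
   contains the rows of an invertible block. *)
have aL j : a j \in L.
  rewrite mem_filter a_coef andbT /=.
  set Xj := [seq y <- points d | fits D%:Z (a j) y].
  have XXj : {subset X <= Xj}.
    move=> y yX; rewrite mem_filter (allP (aX j)) //=.
    by move: yX; rewrite mem_filter => /andP[].
  have -> : (2 * d <= size Xj)%N.
    apply: leq_trans X_large (uniq_leq_size _ XXj).
    by rewrite filter_uniq // words_uniq.
  apply: det_nondegenerate detB _ => i; apply: XXj.
  have -> : word (mxsub f g M i) = x (f i) by apply: eq_map => k; rewrite mxE.
  exact: xX.
have found : search d D%:Z L (points d) L.
  have /allP : search_all d by case: hd => ->; [exact: search_all3 | exact: search_all4].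
  by apply; rewrite mem_iota; lia.
(* The branch of the search that imposes exactly the columns of [M]. *)
pose P b := b \in [seq a j | j <- enum 'I_m].
have LP : [seq a j | j <- enum 'I_m] =i filter P L.
  by move=> b; rewrite mem_filter /P; case: mapP => // -[j _ ->]; rewrite aL.
have XE : X = joint_fit D%:Z (filter P L) (points d).
  by apply: eq_filter => y /=; rewrite (eq_all_r LP).
have := search_sound (P := P) found; rewrite -XE => /(_ X_large).
rewrite /few_atoms; case: ifP => [rows_few _|_].
  exact: bin_le (bin_factor_points D_gt0 aE xX aX) rows_few.
exact: bin_le (bin_factor_functionals D_gt0 aE xX aL aX).
Qed.

Local Close Scope ring_scope.

Theorem theorem2 (R : realType) (n m d : nat) (M : 'M[bool]_(n, m))
  (hd : d = 3 \/ d = 4) (hM : rank_real R M = d) :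
  [/\ d <= rank_bin M <= 2 * d - 2,
      d - 1 <= rank_bool M <= 2 * d - 2
    & d - 1 <= isolation_number M <= 2 * d - 2].
Proof.
have lower := rank_isolation hd hM; have upper := rank_bin_upper hd hM.
have i_le := isolation_le_bool M; have b_le := rank_bool_le_bin M.
have r_le := rank_real_le_bin M R; rewrite hM in r_le.
split; apply/andP; split; lia.
Qed.
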